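(* Let $R$ be an Armendariz ring. Then $R$ is nil-reversible if and only if the polynomial ring $R[x]$ is nil-reversible.
   Context: All rings are associative with identity. For a ring $R$, $N(R)$ denotes the set of all nilpotent elements of $R$. For $a\in R$, $l(a)=\{x\in R: xa=0\}$ and $r(a)=\{x\in R: ax=0\}$. A ring $R$ is nil-reversible if $l(a)=r(a)$ for every $a\in N(R)$. A ring $R$ is Armendariz if whenever $f(x)=\sum_{i=0}^{n}w_ix^i$ and $g(x)=\sum_{j=0}^{m}h_jx^j$ in $R[x]$ satisfy $f(x)g(x)=0$, then $w_ih_j=0$ for all $i,j$. *)

(* Defs.v *)
From HB Require Import structures.
From mathcomp Require Import all_boot all_order all_algebra.
Set Implicit Arguments.
Unset Strict Implicit.
Unset Printing Implicit Defensive.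
Import GRing.Theory.
Local Open Scope ring_scope.

Definition nilpotent_elt (R : nzRingType) (a : R) : Prop :=
  exists n : nat, a ^+ n = 0.

Definition left_ann (R : nzRingType) (a : R) : {pred R} :=
  [pred x | x * a == 0].

Definition right_ann (R : nzRingType) (a : R) : {pred R} :=
  [pred x | a * x == 0].

Definition nil_reversible (R : nzRingType) : Prop :=
  forall a : R, nilpotent_elt a -> left_ann a =i right_ann a.

(* The indices range over all of nat: coefficients beyond the degree are 0. *)
Definition armendariz (R : nzRingType) : Prop :=
  forall f g : {poly R}, f * g = 0 -> forall i j : nat, f`_i * g`_j = 0.

(* Main.v *)
Require Import Defs.
From HB Require Import structures.
From mathcomp Require Import all_boot all_order all_algebra.
Set Implicit Arguments.
Unset Strict Implicit.
Unset Printing Implicit Defensive.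
Import GRing.Theory.
Local Open Scope ring_scope.

(** Over an Armendariz ring, [f * g = 0] means exactly that every coefficient
    of [f] kills every coefficient of [g]; annihilation in [{poly R}] is thus
    a family of annihilations in [R].  Nil-reversibility of [R] reverses each
    of them as soon as the coefficients of a nilpotent polynomial are
    themselves nilpotent ([nilpotent_coef]), which is again a consequence of
    the Armendariz condition, applied once for each factor of [f ^+ n = 0].
    The converse holds because nil-reversibility passes to the subring of
    constant polynomials. *)

Lemma mul_poly_eq0_coef (R : nzRingType) (f g : {poly R}) :
  (forall i j, f`_i * g`_j = 0) -> f * g = 0.
Proof.
move=> fg0; apply/polyP=> k; rewrite coefM coef0.
by apply: big1 => i _; exact: fg0.
Qed.

(** The scalar [c] accumulates the coefficients already extracted: from
    [(c f) f ^+ n = 0] the Armendariz condition turns the factor [c f] into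
    the scalar [c * f`_i], and the remaining power is one shorter. *)
Lemma armendariz_scalar_exp_coef (R : nzRingType) (f : {poly R}) (i n : nat)
    (c : R) :
  armendariz R -> c%:P * f ^+ n = 0 -> c * f`_i ^+ n = 0.
Proof.
move=> armR; elim: n c => [|n IHn] c.
  by rewrite !expr0 !mulr1 => /eqP; rewrite polyC_eq0 => /eqP.
rewrite !exprS !mulrA => /armR cfn0; apply: IHn.
apply/polyP=> k; rewrite coefCM coef0.
by have := cfn0 i k; rewrite coefCM.
Qed.

Lemma nilpotent_coef (R : nzRingType) (f : {poly R}) (i : nat) :
  armendariz R -> nilpotent_elt f -> nilpotent_elt f`_i.
Proof.
move=> armR [n fn0]; exists n; rewrite -[_ ^+ n]mul1r.
by apply: armendariz_scalar_exp_coef; rewrite // fn0 mulr0.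
Qed.

Lemma nil_reversibleP (R : nzRingType) :
  nil_reversible R <->
  forall a x : R, nilpotent_elt a -> x * a = 0 <-> a * x = 0.
Proof.
split=> [revR a x /revR/(_ x) | revR a nil_a x].
  by rewrite !inE => E; split=> /eqP; [rewrite E | rewrite -E] => /eqP.
by rewrite !inE; apply/eqP/eqP=> /(revR a x nil_a).
Qed.

Lemma nil_reversible_poly (R : nzRingType) :
  armendariz R -> nil_reversible R -> nil_reversible {poly R}.
Proof.
move=> armR /nil_reversibleP revR; apply/nil_reversibleP=> f g nil_f.
have nil_coef i : nilpotent_elt f`_i by exact: nilpotent_coef.
split=> /armR ann_coef; apply: mul_poly_eq0_coef => i j.
  by apply/(revR f`_i g`_j).
by apply/(revR f`_j g`_i).
Qed.

Lemma nil_reversible_of_poly (R : nzRingType) :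
  nil_reversible {poly R} -> nil_reversible R.
Proof.
move=> /nil_reversibleP revRx; apply/nil_reversibleP=> a x [n an0].
have nil_aP : nilpotent_elt a%:P by exists n; rewrite -polyC_exp an0.
have [xa_ax ax_xa] := revRx _ x%:P nil_aP.
split=> e0; apply: polyC_inj; rewrite polyCM.
  by apply: xa_ax; rewrite -polyCM e0.
by apply: ax_xa; rewrite -polyCM e0.
Qed.

Theorem proposition3p2 (R : nzRingType) (hR : armendariz R) :
  nil_reversible R <-> nil_reversible {poly R}.
Proof.
by split; [exact: nil_reversible_poly | exact: nil_reversible_of_poly].
Qed.
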